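(* Let $X\subset\mathbb{R}^n$ and $G\subset\mathbb{R}^n$ be orthosymmetric convex bodies. For any sequence of symmetric positive definite matrices $A(k)\in\mathbb{R}^{n\times n}$, $k=1,2,\dots$, there exist vectors $g_i=g_i(k)\in G$, $i=1,\dots,k$, such that the regret of the Euclidean method with matrix $A(k)$ on the linear functions $x\mapsto g_i(k)^\top x$, $i=1,\dots,k$, satisfies $$\liminf_{k\to\infty}\frac{1}{\sqrt k}\sup_{x\in X}\mathrm{Regret}_{k,A(k)}(x)\ \ge\ \sup_{x\in\mathrm{QHull}(X)}\ \sup_{g\in\mathrm{QHull}(G)}x^\top g.$$ Additionally, for each $k$ there exists a diagonal positive definite matrix $D$ such that for any sequence of convex functions $F_1,\dots,F_k:\mathbb{R}^n\to\mathbb{R}$ all of whose subgradients belong to $G$, $$\frac{1}{\sqrt k}\sup_{x\in X}\mathrm{Regret}_{k,D}(x)\ \le\ \sup_{x\in\mathrm{QHull}(X)}\ \sup_{g\in\mathrm{QHull}(G)}x^\top g.$$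
   Context: A convex body is a compact convex set with nonempty interior. A set $C\subset\mathbb{R}^n$ is orthosymmetric if $x\in C$ and $\sigma\in\{\pm1\}^n$ imply $(\sigma_jx_j)_j\in C$. With $C^2=\{(x_j^2)_j:x\in C\}$, the quadratic hull of $C$ is $\mathrm{QHull}(C)=\{(s_j\sqrt{v_j})_j:v\in\mathrm{Conv}(C^2),\ s\in\{\pm1\}^n\}$, which for orthosymmetric convex $C$ is the smallest convex set $Q\supset C$ with $Q^2$ convex. For positive definite $A$ and convex $F_1,\dots,F_k$, the Euclidean method (online mirror descent with $h_A(x)=\frac12x^\top Ax$, unconstrained, started at $0$) plays $x_1=0$ and $x_i=-A^{-1}\sum_{l<i}g_l$ with $g_l\in\partial F_l(x_l)$, and $\mathrm{Regret}_{k,A}(x)=\sum_{i=1}^k[F_i(x_i)-F_i(x)]$. For linear functions $F_i(x)=g_i^\top x$ this is $\sum_{i=1}^kg_i^\top(x_i-x)$. *)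

(* Defs.v *)
From HB Require Import structures.
From mathcomp Require Import all_boot all_order all_algebra.
From mathcomp Require Import all_classical all_reals all_analysis.
Set Implicit Arguments.
Unset Strict Implicit.
Unset Printing Implicit Defensive.
Import Order.TTheory GRing.Theory Num.Theory.
Import numFieldNormedType.Exports.
Local Open Scope classical_set_scope.
Local Open Scope ring_scope.

Definition dotp (R : realType) (n : nat) (x y : 'cV[R]_n) : R :=
  (x^T *m y) ord0 ord0.

Definition posdefmx (R : realType) (n : nat) (A : 'M[R]_n) : Prop :=
  A^T = A /\ forall x : 'cV[R]_n, x != 0 -> 0 < dotp x (A *m x).

Definition convex_body (R : realType) (n : nat) (C : set 'cV[R]_n) : Prop :=
  [/\ compact C, convex_set C & interior C !=set0].

(* A sign vector is encoded by s : 'I_n -> bool, its j-th entry being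
   (-1) ^+ s j. *)
Definition orthosymmetric (R : realType) (n : nat) (C : set 'cV[R]_n) : Prop :=
  forall (x : 'cV[R]_n) (s : 'I_n -> bool),
    C x -> C (\col_j ((-1) ^+ s j * x j ord0)).

Definition convex_hull (R : realType) (n : nat) (C : set 'cV[R]_n) :
  set 'cV[R]_n := smallest (@convex_set R 'cV[R]_n) C.

Definition sqr_set (R : realType) (n : nat) (C : set 'cV[R]_n) :
  set 'cV[R]_n := [set \col_j (x j ord0 ^+ 2) | x in C].

Definition qhull (R : realType) (n : nat) (C : set 'cV[R]_n) :
  set 'cV[R]_n :=
  [set z | exists v (s : 'I_n -> bool), convex_hull (sqr_set C) v /\
    z = \col_j ((-1) ^+ s j * Num.sqrt (v j ord0))].

Definition subdifferential (R : realType) (n : nat) (F : 'cV[R]_n -> R)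
  (x : 'cV[R]_n) : set 'cV[R]_n :=
  [set g | forall y, F x + dotp g (y - x) <= F y].

(* Rounds are numbered from 1; in particular the first iterate is 0. *)
Definition euclidean_iterate (R : realType) (n : nat) (A : 'M[R]_n)
  (g : nat -> 'cV[R]_n) (i : nat) : 'cV[R]_n :=
  - (invmx A *m \sum_(1 <= l < i) g l).

(* The g i are the subgradients returned in a play of k rounds of the Euclidean
   method against F 1, ..., F k; they need not be determined by A and F. *)
Definition euclidean_play (R : realType) (n : nat) (A : 'M[R]_n)
  (F : nat -> 'cV[R]_n -> R) (k : nat) (g : nat -> 'cV[R]_n) : Prop :=
  forall i, (1 <= i <= k)%N ->
    subdifferential (F i) (euclidean_iterate A g i) (g i).

Definition regret (R : realType) (n : nat) (A : 'M[R]_n)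
  (F : nat -> 'cV[R]_n -> R) (g : nat -> 'cV[R]_n) (k : nat)
  (x : 'cV[R]_n) : R :=
  \sum_(1 <= i < k.+1) (F i (euclidean_iterate A g i) - F i x).

Definition sup_regret (R : realType) (n : nat) (X : set 'cV[R]_n)
  (A : 'M[R]_n) (F : nat -> 'cV[R]_n -> R) (g : nat -> 'cV[R]_n) (k : nat) :
  \bar R := ereal_sup [set (regret A F g k x)%:E | x in X].

Definition qhull_pairing (R : realType) (n : nat) (X G : set 'cV[R]_n) :
  \bar R :=
  ereal_sup [set ereal_sup [set (dotp x g)%:E | g in qhull G] | x in qhull X].

Lemma dotpBl (R : realType) (n : nat) (x y z : 'cV[R]_n) :
  dotp (x - y) z = dotp x z - dotp y z.
Proof. by rewrite /dotp linearB mulmxBl !mxE. Qed.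

Lemma dotpBr (R : realType) (n : nat) (x y z : 'cV[R]_n) :
  dotp z (x - y) = dotp z x - dotp z y.
Proof. by rewrite /dotp mulmxBr !mxE. Qed.

Lemma dotp_le0 (R : realType) (n : nat) (x : 'cV[R]_n) :
  dotp x x <= 0 -> x = 0.
Proof.
rewrite /dotp mxE => x0.
have sq0 j : 0 <= (x^T) ord0 j * x j ord0 by rewrite mxE -expr2 sqr_ge0.
have /eqP : \sum_j (x^T) ord0 j * x j ord0 = 0.
  by apply/eqP; rewrite eq_le x0 sumr_ge0.
rewrite psumr_eq0 // => /allP xj; apply/matrixP => j k; rewrite ord1 mxE.
by have := xj j (mem_index_enum j); rewrite mxE -expr2 sqrf_eq0 => /eqP.
Qed.

Lemma subdifferential_dotp (R : realType) (n : nat) (g x : 'cV[R]_n) :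
  subdifferential (dotp g) x = [set g].
Proof.
apply/seteqP; split => [h /= hg|_ -> y /=]; last by rewrite dotpBr subrKC.
apply/eqP; rewrite -subr_eq0; apply/eqP/dotp_le0.
by have := hg (h - g + x); rewrite addrK -lerBrDl -dotpBr addrK -subr_le0 -dotpBl.
Qed.

(* Against linear functions the play is unique, so that
   regret A (fun i => dotp (g i)) g k is the regret of the method on them. *)
Lemma euclidean_play_linear (R : realType) (n : nat) (A : 'M[R]_n)
    (g h : nat -> 'cV[R]_n) (k : nat) :
  euclidean_play A (fun i => dotp (g i)) k h <->
  forall i, (1 <= i <= k)%N -> h i = g i.
Proof.
by split=> hk i ik; have := hk i ik; rewrite subdifferential_dotp.
Qed.

(* Main.v *)
Require Import Defs.
From HB Require Import structures.
From mathcomp Require Import all_boot all_order all_algebra.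
From mathcomp Require Import all_classical all_reals all_analysis.
From mathcomp Require Import ring lra.
Import Order.TTheory GRing.Theory Num.Theory.
Import numFieldNormedType.Exports.
Local Open Scope classical_set_scope.
Local Open Scope ring_scope.
Set Implicit Arguments.
Unset Strict Implicit.
Unset Printing Implicit Defensive.

(** Write B for the inverse of A, S for the sum of the k gradients and V, W for
    the convex hulls of the coordinatewise squares of X and G. Against linear
    functions the regret telescopes into

      - S . x + 1/2 (sum_i g_i . B g_i - S . B S),

    (linear_regretE), and the right-hand side of the theorem is the supremum p
    of sum_j sqrt (v_j w_j) over v in V and w in W.

    Lower bound. Every round plays the same vector gam of G up to signs, so
    that S_j is gam_j times a sum of k signs. One further sign per coordinate,
    the same in all rounds, can be chosen to make the off-diagonal part of B
    harmless, because that part averages to zero over all choices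
    (exists_sign_diag_le). What is left is separable: against the comparator
    - x, with x in X, coordinate j contributes

      S_j x_j + 1/2 b_j (k gam_j^2 - S_j^2),   b_j = B_jj,

    which is maximal at S_j = x_j / b_j, with value
    1/2 (x_j^2 / b_j + k b_j gam_j^2). This is linear in the squares of x and of
    gam, which is how the convex hulls V and W enter: x and gam can be chosen to
    do at least as well as any v in V and w in W, and by the inequality between
    arithmetic and geometric means the total is at least
    sqrt k * sum_j sqrt (v_j w_j). Rounding S_j to a multiple of gam_j of the
    right parity costs one of the k terms gam_j^2, and S_j = x_j / b_j is
    reachable if b_j is not too small, once gam has been moved slightly towards
    a positive point of G (exists_play_large_diag). If some b_j is very small,
    the method hardly reacts in that coordinate, and a regret of larger order
    than sqrt k is available (exists_play_small_diag).

    Upper bound. For D = sqrt k * diag d, completing the square bounds the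
    regret by sqrt k / 2 times the mean over the rounds of
    sum_j d_j x_j^2 + sum_j g_ij^2 / d_j. It remains to find d with

      sum_j d_j v_j + sum_j w_j / d_j <= 2 p   for all v in V, w in W,

    a minimax statement (minimax_scaling): since 2 sqrt (v_j w_j) is the minimum
    over d_j of d_j v_j + w_j / d_j, such a d is given by sqrt (w_j / v_j) at a
    maximizing pair (v, w). As that pair may have zero coordinates, the square
    roots are first smoothed, an almost maximizing pair is used, and the
    resulting d, which stays in a compact box, is passed to the limit. *)

(** * The dot product and quadratic forms *)

Lemma dotpE (R : realType) n (x y : 'cV[R]_n) :
  dotp x y = \sum_j x j ord0 * y j ord0.
Proof. by rewrite /dotp mxE; apply: eq_bigr => j _; rewrite mxE. Qed.

Lemma dotpC (R : realType) n (x y : 'cV[R]_n) : dotp x y = dotp y x.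
Proof. by rewrite !dotpE; apply: eq_bigr => j _; rewrite mulrC. Qed.

Lemma dotpDl (R : realType) n (x y z : 'cV[R]_n) :
  dotp (x + y) z = dotp x z + dotp y z.
Proof. by rewrite /dotp linearD mulmxDl mxE. Qed.

Lemma dotpDr (R : realType) n (x y z : 'cV[R]_n) :
  dotp x (y + z) = dotp x y + dotp x z.
Proof. by rewrite dotpC dotpDl !(dotpC x). Qed.

Lemma dotpNr (R : realType) n (x y : 'cV[R]_n) : dotp x (- y) = - dotp x y.
Proof. by rewrite /dotp mulmxN mxE. Qed.

Lemma dotp_mulmx_sym (R : realType) n (B : 'M[R]_n) (x y : 'cV[R]_n) :
  B^T = B -> dotp x (B *m y) = dotp y (B *m x).
Proof. by move=> BT; rewrite dotpC /dotp trmx_mul BT -mulmxA. Qed.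

Lemma quadratic_formE (R : realType) n (B : 'M[R]_n) (u : 'cV[R]_n) :
  dotp u (B *m u) = \sum_i \sum_j B i j * (u i ord0 * u j ord0).
Proof.
rewrite dotpE; apply: eq_bigr => i _; rewrite mxE big_distrr /=.
by apply: eq_bigr => j _; ring.
Qed.

(** * Positive definite matrices *)

Lemma posdefmx_unit (R : realType) n (A : 'M[R]_n) : posdefmx A -> A \in unitmx.
Proof.
move=> [AT Apos]; rewrite unitmxE unitfE; apply/det0P => -[v v0 vA].
have : v^T != 0.
  by apply: contraNneq v0 => /(congr1 trmx); rewrite trmxK trmx0 => ->.
by move=> /Apos; rewrite /dotp trmxK mulmxA vA mul0mx mxE ltxx.
Qed.

Lemma invmx_sym (R : realType) n (A : 'M[R]_n) :
  A^T = A -> (invmx A)^T = invmx A.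
Proof. by move=> AT; rewrite trmx_inv AT. Qed.

Lemma posdefmx_inv_diag_gt0 (R : realType) n (A : 'M[R]_n) j :
  posdefmx A -> 0 < invmx A j j.
Proof.
move=> pA; have [AT Apos] := pA; have Au := posdefmx_unit pA.
pose e : 'cV[R]_n := delta_mx j ord0.
have -> : invmx A j j = dotp (invmx A *m e) (A *m (invmx A *m e)).
  rewrite mulKVmx // dotpC /dotp trmx_delta mulmxA -rowE -colE !mxE.
  by [].
apply: Apos; apply/eqP => /(congr1 (mulmx A)); rewrite mulKVmx // mulmx0.
by move/matrixP => /(_ j ord0); rewrite !mxE !eqxx => /eqP; rewrite oner_eq0.
Qed.

Lemma posdefmx_diag (R : realType) n (b : 'I_n -> R) :
  (forall j, 0 < b j) -> posdefmx (diag_mx (\row_j b j)).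
Proof.
move=> b0; split=> [|x xn0]; first exact: tr_diag_mx.
have [j xj] : exists j, x j ord0 != 0.
  apply: contrapT => /forallNP x0'; move/eqP: xn0; apply.
  by apply/colP => j; rewrite mxE; apply/eqP; apply: contrapT => /negP /x0'.
rewrite dotpE (bigD1 j) //= ltr_pwDl //.
  rewrite mul_diag_mx !mxE mulrCA -expr2 mulr_gt0 //.
  by rewrite lt_neqAle eq_sym sqr_ge0 sqrf_eq0 xj.
apply: sumr_ge0 => i _; rewrite mul_diag_mx !mxE mulrCA -expr2.
by rewrite mulr_ge0 ?sqr_ge0 // ltW.
Qed.

(** * Regret against linear functions *)

(** Induction on the number of rounds: adding a gradient g to the sum S changes
    the form S . B S by 2 g . B S + g . B g, and - g . B S is the loss of the
    new round. *)
Lemma linear_regretE (R : realType) n (B : 'M[R]_n) (g : nat -> 'cV[R]_n) k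
    (x : 'cV[R]_n) : B^T = B ->
  \sum_(1 <= i < k.+1) dotp (g i) (- (B *m \sum_(1 <= l < i) g l) - x) =
  - dotp (\sum_(1 <= i < k.+1) g i) x
  + 2^-1 * (\sum_(1 <= i < k.+1) dotp (g i) (B *m g i)
            - dotp (\sum_(1 <= i < k.+1) g i)
                   (B *m \sum_(1 <= i < k.+1) g i)).
Proof.
move=> BT; elim: k => [|k IH].
  by rewrite !big_geq // /dotp trmx0 !mul0mx mxE; ring.
have recr (V : nmodType) (f : nat -> V) :
    \sum_(1 <= i < k.+2) f i = \sum_(1 <= i < k.+1) f i + f k.+1.
  exact: big_nat_recr.
rewrite !recr IH; set S := \sum_(1 <= i < k.+1) g i.
rewrite mulmxDr !(dotpDl, dotpDr, dotpNr) (dotp_mulmx_sym S (g k.+1) BT).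
by field.
Qed.

(** Subgradients reduce the regret to that on linear functions; there, the term
    - S . x - 1/2 S . B S is at most 1/2 sum_j b_j x_j^2 by completing the
    square. *)
Lemma diagonal_regret_le (R : realType) n (b : 'I_n -> R)
    (F : nat -> 'cV[R]_n -> R) (g : nat -> 'cV[R]_n) (k : nat) (x : 'cV[R]_n) :
  (forall j, 0 < b j) -> euclidean_play (diag_mx (\row_j b j)) F k g ->
  regret (diag_mx (\row_j b j)) F g k x <=
  2^-1 * (\sum_j b j * x j ord0 ^+ 2
          + \sum_(1 <= i < k.+1) \sum_j (b j)^-1 * g i j ord0 ^+ 2).
Proof.
move=> b0 play; set D := diag_mx _ in play *.
pose B : 'M[R]_n := diag_mx (\row_j (b j)^-1).
have invD : invmx D = B.
  have DB : D *m B = 1%:M.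
    by apply/matrixP => i j; rewrite mulmx_diag !mxE divff // gt_eqF.
  have [Du _] := mulmx1_unit DB.
  by rewrite -[LHS]mulmx1 -DB mulKmx.
have quadB u : dotp u (B *m u) = \sum_j (b j)^-1 * u j ord0 ^+ 2.
  by rewrite dotpE; apply: eq_bigr => j _; rewrite mul_diag_mx !mxE; ring.
apply: le_trans (_ : \sum_(1 <= i < k.+1)
    dotp (g i) (- (B *m \sum_(1 <= l < i) g l) - x) <= _).
  rewrite /regret big_nat_cond [leRHS]big_nat_cond; apply: ler_sum => i.
  rewrite andbT => /andP[i1 ik].
  have := play i; rewrite i1 -ltnS ik => /(_ erefl x).
  rewrite /euclidean_iterate invD -opprB dotpNr; lra.
rewrite linear_regretE ?tr_diag_mx //.
set S := \sum_(1 <= i < k.+1) g i.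
rewrite quadB (eq_bigr (fun i => \sum_j (b j)^-1 * g i j ord0 ^+ 2)); last first.
  by move=> i _; exact: quadB.
suff : - dotp S x - 2^-1 * \sum_j (b j)^-1 * S j ord0 ^+ 2 <=
    2^-1 * \sum_j b j * x j ord0 ^+ 2 by lra.
rewrite dotpE !big_distrr -sumrN -sumrB /=; apply: ler_sum => j _.
have bn0 : b j != 0 by rewrite gt_eqF.
rewrite -subr_ge0.
have -> : 2^-1 * (b j * x j ord0 ^+ 2) -
    (- (S j ord0 * x j ord0) - 2^-1 * ((b j)^-1 * S j ord0 ^+ 2)) =
  2^-1 * (b j * (x j ord0 + S j ord0 / b j) ^+ 2) by field.
by rewrite mulr_ge0 // mulr_ge0 ?sqr_ge0 // ltW.
Qed.

(** * Choosing signs *)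

(** The right-hand side has mean \tr Q over all sign vectors, since flipping one
    sign cancels each off-diagonal product. *)
Lemma exists_sign_diag_le (R : realType) n (Q : 'M[R]_n) :
  exists s : 'I_n -> bool,
    \sum_j Q j j <= \sum_i \sum_j Q i j * ((-1) ^+ s i * (-1) ^+ s j).
Proof.
pose T := {ffun 'I_n -> bool}.
pose q (s : T) := \sum_i \sum_j Q i j * ((-1) ^+ s i * (-1) ^+ s j).
have sum_off i j : i != j -> \sum_(s : T) ((-1) ^+ s i * (-1) ^+ s j) = 0 :> R.
  move=> ij; pose fl (s : T) : T := [ffun l => s l (+) (l == i)].
  have flK : involutive fl.
    by move=> s; apply/ffunP => l; rewrite !ffunE -addbA addbb addbF.
  have : \sum_(s : T) ((-1) ^+ s i * (-1) ^+ s j) =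
         - \sum_(s : T) ((-1) ^+ s i * (-1) ^+ s j) :> R.
    rewrite {1}(reindex_inj (inv_inj flK)) -sumrN; apply: eq_bigr => s _.
    by rewrite !ffunE eqxx eq_sym (negbTE ij) addbF addbT signrN mulNr.
  by move=> e; lra.
have sumq : \sum_(s : T) q s = \sum_(s : T) \sum_j Q j j.
  rewrite /q exchange_big [RHS]exchange_big; apply: eq_bigr => i _ /=.
  rewrite exchange_big (bigD1 i) //= [X in _ + X]big1 => [|j ji].
    by rewrite addr0; apply: eq_bigr => s _; rewrite -expr2 sqrr_sign mulr1.
  by rewrite -big_distrr /= sum_off ?mulr0 // eq_sym.
apply: contrapT => /forallNP small.
have : \sum_(s : T) q s < \sum_(s : T) \sum_j Q j j.
  apply: ltr_sum; first by apply/hasP; exists [ffun=> false]; rewrite ?mem_index_enum.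
  by move=> s _; rewrite ltNge; apply/negP; apply: small.
by rewrite sumq ltxx.
Qed.

Lemma sum_sign_prefix (R : realType) (m k : nat) : (m <= k)%N ->
  \sum_(1 <= i < k.+1) (-1) ^+ (m < i)%N = m%:R * 2 - k%:R :> R.
Proof.
move=> mk; rewrite -(subnKC mk); elim: (k - m)%N => [|d IH].
  rewrite addn0 big_nat_cond (eq_bigr (fun=> 1)) -?big_nat_cond => [|i].
    by rewrite big_const_nat iter_addr_0 subSS subn0 /=; ring.
  by rewrite andbT => /andP[_]; rewrite ltnS ltnNge => ->.
by rewrite addnS big_nat_recr //= IH ltnS leq_addr expr1 -addn1 natrD; ring.
Qed.

(** Sums of k signs are spaced by 2, hence the distance 1. *)
Lemma exists_sign_sum_near (R : realType) (k : nat) (t : R) :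
  0 <= t <= k%:R ->
  exists2 m, (m <= k)%N & `|m%:R * 2 - k%:R - t| <= 1.
Proof.
move=> /andP[t0 tk]; pose y := (k%:R + t + 1) / 2.
have k0 : 0 <= k%:R :> R by exact: ler0n.
have y0 : 0 <= y by rewrite /y; lra.
exists (Num.truncn y).
  rewrite -ltnS -(ltr_nat R).
  apply: (@le_lt_trans _ _ y); first by rewrite truncn_le.
  by rewrite -addn1 natrD /y; lra.
have := truncn_le y; have := truncnS_gt y; rewrite y0 => h1 h2.
rewrite ler_norml; rewrite -addn1 natrD in h1.
by rewrite /y in h1 h2 *; apply/andP; split; lra.
Qed.

(** The regret of a play of gam with signs, m j of them being positive in
    coordinate j, up to a global change of sign of that coordinate. The global
    signs are free by orthosymmetry: they leave the gradients in G, and the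
    comparator can follow them. They are spent on removing the off-diagonal
    entries of the inverse of A. *)
Lemma signed_play_regret (R : realType) n (X G : set 'cV[R]_n) (A : 'M[R]_n)
    (x gam : 'cV[R]_n) (m : 'I_n -> nat) (k : nat) :
  orthosymmetric X -> orthosymmetric G -> (invmx A)^T = invmx A ->
  X x -> G gam -> (forall j, (m j <= k)%N) ->
  let S j := gam j ord0 * ((m j)%:R * 2 - k%:R) in
  exists g : nat -> 'cV[R]_n, (forall i, G (g i)) /\
    exists2 y, X y &
      \sum_j (S j * x j ord0
              + 2^-1 * (invmx A j j * (k%:R * gam j ord0 ^+ 2 - S j ^+ 2)))
      <= regret A (fun i => dotp (g i)) g k y.
Proof.
move=> oX oG; set B := invmx A => BT Xx Ggam mk S.
pose u i j : R := (-1) ^+ (m j < i)%N * gam j ord0.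
have sum_u j : \sum_(1 <= i < k.+1) u i j = S j.
  by rewrite -big_distrl /= sum_sign_prefix // mulrC.
pose Q : 'M[R]_n :=
  \matrix_(j, l) (B j l * (\sum_(1 <= i < k.+1) u i j * u i l - S j * S l)).
have [s sQ] := exists_sign_diag_le Q.
pose g i : 'cV[R]_n := \col_j ((-1) ^+ s j * u i j).
exists g; split=> [i|].
  have /(_ i) := fun i => oG gam (fun j => s j (+) (m j < i)%N) Ggam.
  rewrite (_ : \col__ _ = g i) //; apply/colP => j.
  by rewrite !mxE signr_addb mulrA.
pose y : 'cV[R]_n := \col_j ((-1) ^+ (~~ s j) * x j ord0).
exists y; first exact: oX.
rewrite /regret /euclidean_iterate -/B /=.
under [X in _ <= X]eq_bigr do rewrite -dotpBr.
rewrite linear_regretE //.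
have sum_g j : (\sum_(1 <= i < k.+1) g i) j ord0 = (-1) ^+ s j * S j.
  rewrite summxE -sum_u big_distrr /=; apply: eq_bigr => i _.
  by rewrite mxE.
rewrite big_split /= -big_distrr /=; apply: lerD.
  rewrite dotpE -sumrN; apply: ler_sum => j _; rewrite sum_g !mxE signrN.
  by rewrite mulNr mulrN opprK mulrACA -expr2 sqrr_sign mul1r.
rewrite ler_pM2l ?invr_gt0 ?ltr0n //.
apply: le_trans (_ : \sum_j Q j j <= _).
  apply: ler_sum => j _; rewrite mxE expr2 [S j ^+ 2]expr2.
  rewrite (eq_bigr (fun=> gam j ord0 * gam j ord0)) => [|i _].
    by rewrite big_const_nat iter_addr_0 subSS subn0 mulr_natl.
  by rewrite /u mulrACA -expr2 sqrr_sign mul1r.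
apply: le_trans sQ _.
rewrite quadratic_formE; under [X in _ <= X - _]eq_bigr do rewrite quadratic_formE.
rewrite [X in _ <= X - _]exchange_big -sumrB; apply: ler_sum => j _.
rewrite [X in _ <= X - _]exchange_big -sumrB; apply: ler_sum => l _.
rewrite -big_distrr /= -mulrBr mxE !sum_g -mulrA.
rewrite [X in _ <= _ * (X - _)](eq_bigr
  (fun i => (-1) ^+ s j * (-1) ^+ s l * (u i j * u i l))).
  by rewrite -big_distrr /= [X in _ <= _ * (_ - X)]mulrACA -mulrBr (mulrC (_ - _)).
by move=> i _; rewrite !mxE mulrACA.
Qed.

(** * Orthosymmetric convex bodies and hulls of squares *)

Lemma convex_setE (R : realType) n (C : set 'cV[R]_n) :
  convex_set C <-> forall x y t, 0 <= t -> t <= 1 -> C x -> C y ->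
    C (t *: x + (1 - t) *: y).
Proof.
split=> [cC x y t t0 t1 Cx Cy | cC x y t].
  have := cC x y (Itv01 t0 t1); rewrite !inE; exact.
by rewrite !inE; apply: cC.
Qed.

Lemma orthosymmetric_abs (R : realType) n (C : set 'cV[R]_n) (x : 'cV[R]_n) :
  orthosymmetric C -> C x -> C (\col_j `|x j ord0|).
Proof.
move=> oC /(oC _ (fun j => x j ord0 < 0)); congr (C _).
by apply/colP => j; rewrite !mxE [RHS]normrEsign.
Qed.

Lemma convex_hull_sub (R : realType) n (C P : set 'cV[R]_n) :
  convex_set P -> C `<=` P -> convex_hull C `<=` P.
Proof. exact: smallest_sub. Qed.

Lemma convex_hull_convex (R : realType) n (C : set 'cV[R]_n) :
  convex_set (convex_hull C).
Proof.
apply/convex_setE => x y t t0 t1 Cx Cy P [cP CP].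
by move/convex_setE: (cP); apply => //; [apply: Cx | apply: Cy].
Qed.

(** Otherwise C, and with it its convex hull, would lie in the open half-space
    of the points where the linear form is smaller than at v. *)
Lemma convex_hull_linear_le (R : realType) n (C : set 'cV[R]_n)
    (c : 'I_n -> R) (v : 'cV[R]_n) : convex_hull C v ->
  exists2 x, C x & \sum_j c j * v j ord0 <= \sum_j c j * x j ord0.
Proof.
move=> Cv; apply: contrapT => no.
pose P := [set y : 'cV[R]_n |
  \sum_j c j * y j ord0 < \sum_j c j * v j ord0].
suff : convex_hull C `<=` P by move=> /(_ _ Cv); rewrite /P /= ltxx.
apply: convex_hull_sub => [|x Cx].
  apply/convex_setE => x y t t0 t1; rewrite /P /= => Px Py.
  have -> : \sum_j c j * (t *: x + (1 - t) *: y) j ord0 =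
      t * \sum_j c j * x j ord0 + (1 - t) * \sum_j c j * y j ord0.
    rewrite !big_distrr -big_split /=; apply: eq_bigr => j _.
    by rewrite !mxE; ring.
  have [->|tn0] := eqVneq t 0; first by rewrite mul0r add0r subr0 mul1r.
  have t_gt0 : 0 < t by rewrite lt_neqAle eq_sym tn0.
  by nra.
by rewrite /P /= ltNge; apply/negP => le; apply: no; exists x.
Qed.

Lemma convex_body_bounded (R : realType) n (C : set 'cV[R]_n) :
  convex_body C ->
  exists2 M, 0 < M & forall x, C x -> forall j, `|x j ord0| <= M.
Proof.
move=> [/compact_bounded [M [_ CM]] _ _].
exists (`|M| + 1) => [|x Cx j]; first by rewrite ltr_wpDl.
have ltM : M < `|M| + 1 by rewrite (le_lt_trans (ler_norm M)) ?ltrDl.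
apply: le_trans (CM _ ltM _ Cx).
rewrite [leRHS]/Num.norm /= mx_normrE.
exact: (le_bigmax _ (fun ij => `|x ij.1 ij.2|) (j, ord0)).
Qed.

(** Pushing an interior point away from the coordinate hyperplanes and then
    reflecting it into the positive orthant. *)
Lemma orthosymmetric_body_positive (R : realType) n (C : set 'cV[R]_n) :
  convex_body C -> orthosymmetric C ->
  exists2 r, 0 < r & exists2 x, C x & forall j, r <= x j ord0.
Proof.
move=> [_ _ [z]]; rewrite /interior /= => /nbhs_ballP [e /= e0 ballC] oC.
exists (e / 2); first by rewrite divr_gt0.
pose y := z + \col_j ((-1) ^+ (z j ord0 < 0)%R * (e / 2)).
have Cy : C y.
  apply: ballC; split => // i j; rewrite ord1 !mxE.
  rewrite -ball_normE /= opprD addrA subrr sub0r normrN normrM normr_sign mul1r.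
  by rewrite gtr0_norm; lra.
exists (\col_j `|y j ord0|) => [|j]; first exact: orthosymmetric_abs.
rewrite !mxE; case: ltP => z0; rewrite ?expr1 ?expr0.
  by rewrite ltr0_norm; lra.
by rewrite ger0_norm; lra.
Qed.

Lemma sqr_hull_bounds (R : realType) n (C : set 'cV[R]_n) (M : R) v :
  (forall x, C x -> forall j, `|x j ord0| <= M) ->
  convex_hull (sqr_set C) v -> forall j, 0 <= v j ord0 <= M ^+ 2.
Proof.
move=> CM; move: v; apply: convex_hull_sub.
  apply/convex_setE => x y t t0 t1 Px Py j; rewrite !mxE.
  have /andP[x0 xM] := Px j; have /andP[y0 yM] := Py j.
  by apply/andP; split; nra.
move=> _ [x Cx <-] j; rewrite mxE sqr_ge0 /=.
rewrite -real_normK ?num_real // lerXn2r ?nnegrE ?normr_ge0 ?CM //.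
exact: le_trans (CM _ Cx j).
Qed.

(** Together with the next lemma, this reduces the pairing of the two quadratic
    hulls to the squares: at given v and w, equal signs are optimal. *)
Lemma qhull_pairing_ge (R : realType) n (X G : set 'cV[R]_n) v w :
  convex_hull (sqr_set X) v -> convex_hull (sqr_set G) w ->
  ((\sum_j Num.sqrt (v j ord0) * Num.sqrt (w j ord0))%:E
    <= qhull_pairing X G)%E.
Proof.
move=> Xv Gw.
pose root (u : 'cV[R]_n) : 'cV[R]_n :=
  \col_j ((-1) ^+ false * Num.sqrt (u j ord0)).
apply: (@le_trans _ _ (ereal_sup [set (dotp (root v) g)%:E | g in qhull G])).
  apply: ereal_sup_ubound; exists (root w).
    by exists w, (fun=> false).
  rewrite dotpE; congr EFin; apply: eq_bigr => j _.
  by rewrite !mxE !expr0 !mul1r.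
by apply: ereal_sup_ubound; exists (root v) => //; exists v, (fun=> false).
Qed.

Lemma qhull_pairing_le (R : realType) n (X G : set 'cV[R]_n) (c : R) :
  (forall v w, convex_hull (sqr_set X) v -> convex_hull (sqr_set G) w ->
    \sum_j Num.sqrt (v j ord0) * Num.sqrt (w j ord0) <= c) ->
  (qhull_pairing X G <= c%:E)%E.
Proof.
move=> le_c; apply: ge_ereal_sup => _ [x [v [s [Xv ->]]] <-].
apply: ge_ereal_sup => _ [g [w [s' [Gw ->]]] <-].
rewrite lee_fin; apply: le_trans (le_c _ _ Xv Gw).
rewrite dotpE; apply: ler_sum => j _; rewrite !mxE mulrACA -signr_addb.
have := mulr_ge0 (sqrtr_ge0 (v j ord0)) (sqrtr_ge0 (w j ord0)).
by case: (_ (+) _); rewrite ?expr1 ?expr0 => ?; lra.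
Qed.

(** * The minimax scaling *)

(** With x = u s^2 this is 1 + u/2 - u^2/2 <= sqrt (1 + u), which holds up to
    u = 3; beyond u = 2 the left-hand side is negative. *)
Lemma sqrt_ge_second_order (R : realType) (s x : R) : 0 < s -> 0 <= s ^+ 2 + x ->
  s + x / (2 * s) - x ^+ 2 / (2 * s ^+ 3) <= Num.sqrt (s ^+ 2 + x).
Proof.
move=> s0; have sn0 : s != 0 by rewrite gt_eqF.
have [u ->] : exists u, x = u * s ^+ 2 by exists (x / s ^+ 2); field.
have -> : s ^+ 2 + u * s ^+ 2 = s ^+ 2 * (1 + u) by ring.
rewrite pmulr_rge0 ?exprn_gt0 // => u_ge.
have -> : s + u * s ^+ 2 / (2 * s) - (u * s ^+ 2) ^+ 2 / (2 * s ^+ 3) =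
  s * (1 + u / 2 - u ^+ 2 / 2) by field.
rewrite sqrtrM ?sqr_ge0 // sqrtr_sqr gtr0_norm // ler_pM2l //.
have [neg|pos] := lerP (1 + u / 2 - u ^+ 2 / 2) 0.
  exact: le_trans neg (sqrtr_ge0 _).
rewrite -(ger0_norm (ltW pos)) -sqrtr_sqr ler_sqrt //.
have u3 : u <= 3 by rewrite expr2 in pos; nra.
have -> : (1 + u / 2 - u ^+ 2 / 2) ^+ 2 =
  1 + u - (u ^+ 2 / 4) * ((1 + u) * (3 - u)) by field.
rewrite gerBl mulr_ge0 // ?divr_ge0 ?sqr_ge0 //.
by rewrite mulr_ge0 // subr_ge0.
Qed.

(** A quantitative first-order condition at an almost maximizing point v1 of a
    sum of smoothed square roots on a convex set: moving from v1 by a fraction t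
    towards v gains at most del. The smoothing th bounds the second-order
    term. *)
Lemma near_max_first_order (R : realType) n (V : set 'cV[R]_n)
    (c : 'I_n -> R) (M L th del t : R) (v1 : 'cV[R]_n) :
  convex_set V -> (forall v, V v -> forall j, 0 <= v j ord0 <= M ^+ 2) ->
  (forall j, 0 <= c j <= L) -> 0 < th -> 0 <= t <= 1 -> V v1 ->
  (forall v, V v -> \sum_j c j * Num.sqrt (v j ord0 + th ^+ 2) <=
                    \sum_j c j * Num.sqrt (v1 j ord0 + th ^+ 2) + del) ->
  forall v, V v ->
    t * \sum_j c j / Num.sqrt (v1 j ord0 + th ^+ 2) * (v j ord0 - v1 j ord0)
    <= 2 * del + t ^+ 2 * (n%:R * (L * M ^+ 4 / th ^+ 3)).
Proof.
move=> /convex_setE cV V_le c_le th0 /andP[t0 t1] Vv1 v1max v Vv.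
have := v1max _ (cV v v1 t t0 t1 Vv Vv1).
rewrite -lerBlDl -sumrB -(@ler_pM2l _ 2) // => first_order.
have -> : n%:R * (L * M ^+ 4 / th ^+ 3) = \sum_(j < n) (L * M ^+ 4 / th ^+ 3).
  by rewrite sumr_const card_ord mulr_natl.
rewrite -lerBlDr; apply: le_trans first_order.
rewrite !big_distrr -sumrB /=; apply: ler_sum => j _.
have /andP[v10 v1M] := V_le _ Vv1 j; have /andP[v0 vM] := V_le _ Vv j.
have /andP[c0 cL] := c_le j.
set s := Num.sqrt (v1 j ord0 + th ^+ 2).
have th2 : 0 < th ^+ 2 by exact: exprn_gt0.
have s2 : s ^+ 2 = v1 j ord0 + th ^+ 2 by rewrite sqr_sqrtr // addr_ge0 // ltW.
have ths : th <= s.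
  by rewrite -(gtr0_norm th0) -sqrtr_sqr ler_wsqrtr // lerDr.
have s0 : 0 < s by exact: lt_le_trans ths.
have sn0 : s != 0 by rewrite gt_eqF.
pose x := t * (v j ord0 - v1 j ord0).
have -> : (t *: v + (1 - t) *: v1) j ord0 + th ^+ 2 = s ^+ 2 + x.
  by rewrite s2 !mxE /x; ring.
have sx0 : 0 <= s ^+ 2 + x by rewrite s2 /x; nra.
have sqrt_x := ler_wpM2l c0 (sqrt_ge_second_order s0 sx0).
have x2 : x ^+ 2 <= t ^+ 2 * M ^+ 4.
  rewrite /x exprMn ler_wpM2l ?sqr_ge0 // (_ : M ^+ 4 = (M ^+ 2) ^+ 2).
    rewrite -real_normK ?num_real // ler_sqr ?nnegrE ?sqr_ge0 //.
    by rewrite ler_norml; lra.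
  by ring.
have cs : c j / s ^+ 3 <= L / th ^+ 3.
  apply: ler_pM => //; first by rewrite invr_ge0 exprn_ge0 // ltW.
  by rewrite lef_pV2 ?posrE ?exprn_gt0 // lerXn2r // nnegrE ltW.
have quad : c j / s ^+ 3 * x ^+ 2 <= L / th ^+ 3 * (t ^+ 2 * M ^+ 4).
  by apply: ler_pM; rewrite ?sqr_ge0 // divr_ge0 // exprn_ge0 // ltW.
have -> : t * (c j / s * (v j ord0 - v1 j ord0)) -
    t ^+ 2 * (L * M ^+ 4 / th ^+ 3) =
  c j / s * x - L / th ^+ 3 * (t ^+ 2 * M ^+ 4) by rewrite /x; ring.
have split_c : 2 * (c j * (s + x / (2 * s) - x ^+ 2 / (2 * s ^+ 3))) =
  2 * (c j * s) + c j / s * x - c j / s ^+ 3 * x ^+ 2 by field.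
lra.
Qed.

(** Let (v1, w1) almost maximize sum_j sqrt ((v_j + th^2) (w_j + th^2)) and
    let d_j be the ratio of the two roots in coordinate j. Almost maximality in
    v and in w separately bounds sum_j d_j (v_j - v1_j) and
    sum_j (w_j - w1_j) / d_j, while at (v1, w1) itself either sum is at most
    the smoothed objective, hence at most p + O(th). *)
Lemma approx_minimax_scaling (R : realType) n (V W : set 'cV[R]_n)
    (M p th : R) :
  convex_set V -> convex_set W -> V !=set0 -> W !=set0 ->
  (forall v, V v -> forall j, 0 <= v j ord0 <= M ^+ 2) ->
  (forall w, W w -> forall j, 0 <= w j ord0 <= M ^+ 2) ->
  0 <= M -> 0 < th <= 1 ->
  (forall v w, V v -> W w ->
    \sum_j Num.sqrt (v j ord0) * Num.sqrt (w j ord0) <= p) ->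
  exists d : 'I_n -> R, (forall j, 0 < d j) /\
    forall v w, V v -> W w ->
      \sum_j d j * v j ord0 + \sum_j (d j)^-1 * w j ord0 <=
      2 * p + th * (2 * n%:R * (2 * M + 1) + 2).
Proof.
move=> cV cW [v0 Vv0] [w0 Ww0] V_le W_le M0 /andP[th0 th1] le_p.
have th2 : 0 < th ^+ 2 by exact: exprn_gt0.
pose rt (u : 'cV[R]_n) j := Num.sqrt (u j ord0 + th ^+ 2).
pose f v w := \sum_j rt v j * rt w j.
have rt_gt0 (u : 'cV[R]_n) j : 0 <= u j ord0 -> 0 < rt u j.
  by move=> u0; rewrite sqrtr_gt0 ltr_wpDl.
have rt_le (u : 'cV[R]_n) j : 0 <= u j ord0 -> rt u j <= Num.sqrt (u j ord0) + th.
  move=> u0; have su := sqrtr_ge0 (u j ord0).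
  have sth : 0 <= Num.sqrt (u j ord0) + th by rewrite addr_ge0 // ltW.
  rewrite -(ger0_norm sth) -sqrtr_sqr ler_wsqrtr //.
  by rewrite sqrrD sqr_sqrtr // lerD2r lerDl mulrn_wge0 // mulr_ge0 // ltW.
have sqrt_le (u : 'cV[R]_n) j : 0 <= u j ord0 <= M ^+ 2 -> Num.sqrt (u j ord0) <= M.
  by move=> /andP[u0 uM]; rewrite -(ger0_norm M0) -sqrtr_sqr ler_wsqrtr.
have f_le v w : V v -> W w -> f v w <= p + th * (n%:R * (2 * M + 1)).
  move=> Vv Ww.
  have -> : th * (n%:R * (2 * M + 1)) = \sum_(j < n) (th * (2 * M + 1)).
    by rewrite sumr_const card_ord -[RHS]mulr_natl mulrCA.
  apply: le_trans (lerD (le_p _ _ Vv Ww) (lexx _)).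
  rewrite -big_split /=; apply: ler_sum => j _.
  have v_ge0 : 0 <= v j ord0 by have /andP[] := V_le _ Vv j.
  have w_ge0 : 0 <= w j ord0 by have /andP[] := W_le _ Ww j.
  have := sqrt_le _ _ (V_le _ Vv j); have := sqrt_le _ _ (W_le _ Ww j).
  have := rt_le _ _ v_ge0; have := rt_le _ _ w_ge0.
  have := rt_gt0 _ _ v_ge0; have := rt_gt0 _ _ w_ge0.
  have := sqrtr_ge0 (v j ord0); have := sqrtr_ge0 (w j ord0).
  set sv := Num.sqrt (v j ord0); set sw := Num.sqrt (w j ord0).
  move=> sw0 sv0 rw0 rv0 rwle rvle swM svM.
  apply: le_trans (_ : (sv + th) * (sw + th) <= _).
    by apply: ler_pM => //; exact: ltW.
  by nra.
(* t is small enough for the quadratic error K t ^+ 2 of the first-order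
   condition to be at most th t. *)
pose K := n%:R * ((M + 1) * M ^+ 4 / th ^+ 3).
have K0 : 0 <= K.
  rewrite mulr_ge0 // divr_ge0 ?exprn_ge0 // ?(ltW th0) // mulr_ge0 ?exprn_ge0 //.
  lra.
pose t := th / (2 * K + 1).
have K1 : 0 < 2 * K + 1 by lra.
have t0 : 0 < t by exact: divr_gt0.
have t1 : t <= 1 by rewrite ler_pdivrMr //; lra.
have tK : t * K <= th / 2.
  rewrite /t mulrAC ler_pdivrMr //; nra.
pose del := t * th / 4.
have del0 : 0 < del by rewrite divr_gt0 // mulr_gt0.
have err : 2 * del + t ^+ 2 * K <= t * th.
  have : t * (t * K) <= t * (th / 2) by rewrite ler_pM2l.
  by rewrite expr2 -mulrA /del; lra.
pose E := [set e | exists v w, [/\ V v, W w & e = f v w]].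
have supE : has_sup E.
  split; first by exists (f v0 w0), v0, w0.
  by exists (p + th * (n%:R * (2 * M + 1))) => _ [v [w [Vv Ww ->]]]; exact: f_le.
have [_ [v1 [w1 [Vv1 Ww1 ->]]] near_sup] := sup_adherent del0 supE.
have f_near v w : V v -> W w -> f v w <= f v1 w1 + del.
  move=> Vv Ww; rewrite -lerBlDr; apply: le_trans (ltW near_sup).
  by rewrite lerD2r; apply: (ub_le_sup supE.2); exists v, w.
have v1_ge0 j : 0 <= v1 j ord0 by have /andP[] := V_le _ Vv1 j.
have w1_ge0 j : 0 <= w1 j ord0 by have /andP[] := W_le _ Ww1 j.
have rt_bound (u : 'cV[R]_n) : (forall j, 0 <= u j ord0 <= M ^+ 2) ->
    forall j, 0 <= rt u j <= M + 1.
  move=> uP j; have /andP[u0 _] := uP j; rewrite ltW ?rt_gt0 //=.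
  apply: le_trans (rt_le _ _ u0) _; have := sqrt_le _ _ (uP j); lra.
have t01 : 0 <= t <= 1 by rewrite (ltW t0).
have foV v (Vv : V v) : \sum_j rt w1 j / rt v1 j * (v j ord0 - v1 j ord0) <= th.
  rewrite -(ler_pM2l t0).
  apply: le_trans (near_max_first_order cV V_le (rt_bound _ (W_le _ Ww1))
    th0 t01 Vv1 _ Vv) _.
    move=> u Vu; have := f_near _ _ Vu Ww1; rewrite /f.
    under eq_bigr do rewrite mulrC.
    by under [X in _ <= X + _]eq_bigr do rewrite mulrC; exact.
  by rewrite -/K; lra.
have foW w (Ww : W w) : \sum_j rt v1 j / rt w1 j * (w j ord0 - w1 j ord0) <= th.
  rewrite -(ler_pM2l t0).
  apply: le_trans (near_max_first_order cW W_le (rt_bound _ (V_le _ Vv1))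
    th0 t01 Ww1 _ Ww) _.
    by move=> u Wu; exact: f_near _ _ Vv1 Wu.
  by rewrite -/K; lra.
exists (fun j => rt w1 j / rt v1 j); split=> [j|v w Vv Ww].
  by rewrite divr_gt0 ?rt_gt0.
have := foV _ Vv; have := foW _ Ww; have := f_le _ _ Vv1 Ww1.
have sqr_rt (u : 'cV[R]_n) j : 0 <= u j ord0 -> u j ord0 <= rt u j ^+ 2.
  by move=> u0; rewrite sqr_sqrtr ?lerDl ?(ltW th2) // addr_ge0 // ltW.
have base (u u' a : 'cV[R]_n) : (forall j, 0 <= u j ord0) ->
    (forall j, 0 <= u' j ord0) ->
    \sum_j rt u' j / rt u j * a j ord0 <=
    f u u' + \sum_j rt u' j / rt u j * (a j ord0 - u j ord0).
  move=> u0 u'0; rewrite -big_split /=; apply: ler_sum => j _.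
  have ru := rt_gt0 _ _ (u0 j); have ru' := rt_gt0 _ _ (u'0 j).
  have -> : rt u j * rt u' j = rt u' j / rt u j * rt u j ^+ 2.
    by field; rewrite gt_eqF.
  rewrite -mulrDr ler_wpM2l ?(divr_ge0 (ltW ru') (ltW ru)) //.
  by have := sqr_rt _ _ (u0 j); lra.
have := base v1 w1 v v1_ge0 w1_ge0; have := base w1 v1 w w1_ge0 v1_ge0.
have -> : f w1 v1 = f v1 w1 by apply: eq_bigr => j _; rewrite mulrC.
under [X in _ -> _ -> _ -> _ -> _ -> _ + X <= _]eq_bigr do rewrite invf_div.
by rewrite -[2 * n%:R * _]mulrA; lra.
Qed.

(** The approximate scalings for smoothing th tending to 0 all lie in a common
    box, because V and W contain points with coordinates at least r: there, the
    bound on the two sums controls each d_j and each inverse. A cluster point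
    inherits every inequality in the limit. *)
Lemma minimax_scaling (R : realType) n (V W : set 'cV[R]_n) (M p r : R)
    (v0 w0 : 'cV[R]_n) :
  convex_set V -> convex_set W ->
  (forall v, V v -> forall j, 0 <= v j ord0 <= M ^+ 2) ->
  (forall w, W w -> forall j, 0 <= w j ord0 <= M ^+ 2) -> 0 <= M ->
  0 < r -> V v0 -> W w0 ->
  (forall j, r <= v0 j ord0) -> (forall j, r <= w0 j ord0) ->
  (forall v w, V v -> W w ->
    \sum_j Num.sqrt (v j ord0) * Num.sqrt (w j ord0) <= p) ->
  exists d : 'I_n -> R, (forall j, 0 < d j) /\
    forall v w, V v -> W w ->
      \sum_j d j * v j ord0 + \sum_j (d j)^-1 * w j ord0 <= 2 * p.
Proof.
move=> cV cW V_le W_le M0 r0 Vv0 Ww0 v0r w0r le_p.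
pose C := 2 * n%:R * (2 * M + 1) + 2.
have C0 : 0 <= C.
  by rewrite addr_ge0 // mulr_ge0 ?mulr_ge0 //; lra.
pose th m : R := m.+1%:R^-1.
have th01 m : 0 < th m <= 1 by rewrite invr_gt0 ltr0n /= invf_le1 ?ltr0n // ler1n.
have /choice [d dP] : forall m, exists d : 'rV[R]_n, (forall j, 0 < d ord0 j) /\
    forall v w, V v -> W w ->
      \sum_j d ord0 j * v j ord0 + \sum_j (d ord0 j)^-1 * w j ord0 <=
      2 * p + th m * C.
  move=> m; have [||d [d0 dP]] :=
    approx_minimax_scaling cV cW _ _ V_le W_le M0 (th01 m) le_p.
  - by exists v0.
  - by exists w0.
  exists (\row_j d j); split=> [j|v w Vv Ww]; first by rewrite mxE.
  apply: le_trans (dP _ _ Vv Ww); under eq_bigr do rewrite mxE.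
  by under [X in _ + X <= _]eq_bigr do rewrite mxE.
have p0 : 0 <= p.
  apply: le_trans (le_p _ _ Vv0 Ww0); apply: sumr_ge0 => j _.
  by rewrite mulr_ge0 ?sqrtr_ge0.
pose B := (2 * p + C) / r + 1.
have dB m j : d m ord0 j \in `[B^-1, B].
  have [dm0 /(_ _ _ Vv0 Ww0) dm] := dP m.
  have thC : th m * C <= C by have /andP[_ ?] := th01 m; rewrite ler_piMl.
  have term (c : 'I_n -> R) (u : 'cV[R]_n) : (forall j, 0 < c j) ->
      (forall j, r <= u j ord0) -> c j * r <= \sum_j c j * u j ord0.
    move=> c0 ur; rewrite (bigD1 j) //=.
    apply: le_trans (_ : c j * u j ord0 <= _); first by rewrite ler_pM2l.
    rewrite lerDl; apply: sumr_ge0 => i _; rewrite mulr_ge0 ?(ltW (c0 i)) //.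
    exact: le_trans (ltW r0) (ur i).
  have sum0 (c : 'I_n -> R) (u : 'cV[R]_n) : (forall j, 0 < c j) ->
      (forall j, r <= u j ord0) -> 0 <= \sum_j c j * u j ord0.
    by move=> c0 ur; apply: le_trans (term c u c0 ur); rewrite mulr_ge0 ?ltW.
  have di0 i : 0 < (d m ord0 i)^-1 by rewrite invr_gt0.
  have dr := term _ _ dm0 v0r; have dir := term _ _ di0 w0r.
  have sv := sum0 _ _ dm0 v0r; have sw := sum0 _ _ di0 w0r.
  have dB : d m ord0 j <= B.
    by rewrite -lerBlDr ler_pdivlMr //; nra.
  have diB : (d m ord0 j)^-1 <= B.
    by rewrite -lerBlDr ler_pdivlMr //; nra.
  rewrite in_itv /= dB andbT -[leRHS]invrK lef_pV2 ?posrE //.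
  exact: lt_le_trans diB.
have box_compact := rV_compact (fun j : 'I_n => @segment_compact R B^-1 B).
have [|a [aB acl]] := box_compact (d @ \oo) _.
  by exists 0%N => // m _ j; exact: dB.
move: acl; rewrite cluster_cvgE => -[F FF [Fa dF]].
have B0 : 0 < B.
  by rewrite ltr_wpDl // divr_ge0 ?(ltW r0) // addr_ge0 // mulr_ge0.
have a0 j : 0 < a ord0 j.
  have := aB j; rewrite /= in_itv /= => /andP[+ _].
  by apply: lt_le_trans; rewrite invr_gt0.
exists (fun j => a ord0 j); split=> // v w Vv Ww.
apply/ler_addgt0Pr => e e0.
pose phi (x : 'rV[R]_n) :=
  \sum_j x ord0 j * v j ord0 + \sum_j (x ord0 j)^-1 * w j ord0.
have phi_cvg : phi x @[x --> F] --> phi a.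
  have coord j : (x ord0 j) @[x --> F] --> a ord0 j.
    exact: cvg_trans (cvg_app _ Fa) (@coord_continuous R 1 n ord0 j a).
  apply: cvgD; apply: cvg_big => [|j _]; try exact: add_continuous.
    by apply: cvgM; [exact: coord | exact: cvg_cst].
  apply: cvgM; last exact: cvg_cst.
  by apply: cvgV; [rewrite gt_eqF | exact: coord].
apply: (cvgr_to_le phi_cvg); apply: dF.
have [N NP] : exists N, forall m, (N <= m)%N -> th m * C <= e.
  exists (Num.truncn (C / e)) => m Nm.
  rewrite mulrC ler_pdivrMr ?ltr0n // mulrC -ler_pdivrMr //.
  apply: le_trans (ltW (truncnS_gt _)) _; by rewrite ler_nat.
exists N => // m /= Nm.
have [_ /(_ _ _ Vv Ww) dm] := dP m.
by apply: le_trans dm _; rewrite lerD2l NP.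
Qed.

(** * Separable regret *)

(** Completing the square at the target S = x / b: a rounding of S with error
    at most gam loses at most b gam^2 / 2, that is, one of the k rounds. *)
Lemma exists_rounding_sum_ge (R : realType) n (b x gam : 'I_n -> R) (k : nat) :
  (forall j, 0 < b j) -> (forall j, 0 < gam j) -> (forall j, 0 <= x j) ->
  (forall j, x j <= b j * gam j * k%:R) ->
  exists2 m : 'I_n -> nat, (forall j, (m j <= k)%N) &
    forall j, let S := gam j * ((m j)%:R * 2 - k%:R) in
      2^-1 * (x j ^+ 2 / b j + b j * ((k%:R - 1) * gam j ^+ 2)) <=
      S * x j + 2^-1 * (b j * (k%:R * gam j ^+ 2 - S ^+ 2)).
Proof.
move=> b0 gam0 x0 xk.
have /choice [m mP] : forall j, exists m, (m <= k)%N /\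
    `|m%:R * 2 - k%:R - x j / (b j * gam j)| <= 1.
  move=> j; have [|m] := @exists_sign_sum_near R k (x j / (b j * gam j)).
    have bg : 0 < b j * gam j by rewrite mulr_gt0.
    rewrite ler_pdivrMr // [k%:R * _]mulrC xk andbT.
    by rewrite divr_ge0 // ltW.
  by exists m.
exists m => j; first by have [] := mP j.
have [_] := mP j; set T := _ - k%:R => Tnear /=.
set t := x j / (b j * gam j) in Tnear.
have bn0 : b j != 0 by rewrite gt_eqF.
have gn0 : gam j != 0 by rewrite gt_eqF.
have -> : x j = t * (b j * gam j) by rewrite /t; field; rewrite bn0 gn0.
rewrite -subr_ge0.
rewrite (_ : _ - _ = 2^-1 * (b j * gam j ^+ 2) * (1 - (T - t) ^+ 2)); last first.
  by field.
apply: mulr_ge0; first by rewrite mulr_ge0 // ?mulr_ge0 ?sqr_ge0 ?ltW.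
by rewrite subr_ge0 -real_normK ?num_real // expr_le1.
Qed.

(** The inequality between arithmetic and geometric means, coordinatewise. *)
Lemma sum_sqrt_le_trade_off (R : realType) n (b v w : 'I_n -> R) (kap : R) :
  (forall j, 0 < b j) -> (forall j, 0 <= v j) -> (forall j, 0 <= w j) ->
  kap * \sum_j Num.sqrt (v j) * Num.sqrt (w j) <=
  2^-1 * (\sum_j (b j)^-1 * v j + kap ^+ 2 * \sum_j b j * w j).
Proof.
move=> b0 v0 w0; rewrite !big_distrr -big_split big_distrr /=.
apply: ler_sum => j _.
rewrite -{2}(sqr_sqrtr (v0 j)) -{2}(sqr_sqrtr (w0 j)).
set sv := Num.sqrt (v j); set sw := Num.sqrt (w j).
have bn0 : b j != 0 by rewrite gt_eqF.
rewrite -subr_ge0 (_ : _ - _ = 2^-1 * ((sv - kap * b j * sw) ^+ 2 / b j)).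
  by rewrite mulr_ge0 // divr_ge0 ?sqr_ge0 ?ltW.
by field.
Qed.

(** * Regret bounds for orthosymmetric bodies *)

Section Bodies.
Variables (R : realType) (n : nat) (X G : set 'cV[R]_n) (M r : R).
Variables (x0 g0 : 'cV[R]_n).
Hypothesis G_convex : convex_set G.
Hypotheses (X_ortho : orthosymmetric X) (G_ortho : orthosymmetric G).
Hypotheses (r_gt0 : 0 < r) (M_ge0 : 0 <= M).
Hypotheses (Xx0 : X x0) (Gg0 : G g0).
Hypotheses (x0_ge : forall j, r <= x0 j ord0) (g0_ge : forall j, r <= g0 j ord0).
Hypothesis X_le : forall x, X x -> forall j, `|x j ord0| <= M.
Hypothesis G_le : forall x, G x -> forall j, `|x j ord0| <= M.

(** The case in which every x_j / b_j can be reached by S_j. The vector gam is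
    |g| moved by a fraction 1/q towards g0, so that gam_j >= r / q; as k = q^4,
    the largest reachable S_j is then at least r q^3. *)
Lemma exists_play_large_diag (b : 'I_n -> R) (v w : 'cV[R]_n) (q : R) (k : nat) :
  1 <= q -> k%:R = q ^+ 4 ->
  convex_hull (sqr_set X) v -> convex_hull (sqr_set G) w ->
  (forall j, 0 < b j) -> (forall j, M <= b j * (r * q ^+ 3)) ->
  exists x gam (m : 'I_n -> nat), [/\ X x, G gam, forall j, (m j <= k)%N &
    let S j := gam j ord0 * ((m j)%:R * 2 - k%:R) in
    (q - 1) ^+ 2 * \sum_j Num.sqrt (v j ord0) * Num.sqrt (w j ord0) <=
    \sum_j (S j * x j ord0
            + 2^-1 * (b j * (k%:R * gam j ord0 ^+ 2 - S j ^+ 2)))].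
Proof.
move=> q1 kq Xv Gw b0 bM; have q0 : 0 < q by exact: lt_le_trans q1.
have qn0 : q != 0 by rewrite gt_eqF.
have [_ [x Xx <-] vx] := convex_hull_linear_le (fun j => (b j)^-1) Xv.
have [_ [g Gg <-] wg] := convex_hull_linear_le b Gw.
pose ax : 'cV[R]_n := \col_j `|x j ord0|.
pose h := q^-1; pose gam : 'cV[R]_n := (1 - h) *: \col_j `|g j ord0| + h *: g0.
have h0 : 0 < h by rewrite invr_gt0.
have h1 : h <= 1 by rewrite invf_le1.
have Ggam : G gam.
  have /convex_setE cG := G_convex.
  rewrite /gam -{2}(subKr 1 h); apply: cG => //; try lra.
  exact: orthosymmetric_abs.
have gam_ge j : (1 - h) * `|g j ord0| + h * r <= gam j ord0.
  by rewrite !mxE lerD2l ler_pM2l.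
have gam_hr j : h * r <= gam j ord0.
  apply: le_trans (gam_ge j); rewrite lerDr mulr_ge0 //; lra.
have hr0 : 0 < h * r by exact: mulr_gt0.
have [||||m mk mP] := @exists_rounding_sum_ge R n b (fun j => ax j ord0)
  (fun j => gam j ord0) k => //.
- by move=> j; apply: lt_le_trans (gam_hr j).
- by move=> j; rewrite mxE.
- move=> j; rewrite mxE kq; apply: le_trans (X_le Xx j) _.
  apply: le_trans (bM j) _; rewrite -mulrA ler_pM2l //.
  rewrite (_ : r * q ^+ 3 = h * r * q ^+ 4); last by rewrite /h; field.
  by rewrite ler_pM2r ?exprn_gt0.
exists ax, gam, m; split => //; first exact: orthosymmetric_abs.
apply: le_trans (ler_sum _ (fun j _ => mP j)).
have v0 j : 0 <= v j ord0 by have /andP[] := sqr_hull_bounds X_le Xv j.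
have w0 j : 0 <= w j ord0 by have /andP[] := sqr_hull_bounds G_le Gw j.
apply: le_trans (sum_sqrt_le_trade_off _ b0 v0 w0) _.
rewrite -big_distrr ler_pM2l ?invr_gt0 ?ltr0n // big_split /=; apply: lerD.
  apply: le_trans vx _; apply: ler_sum => j _.
  by rewrite !mxE real_normK ?num_real // mulrC.
apply: (@le_trans _ _ ((q - 1) ^+ 2 ^+ 2 * \sum_j b j * `|g j ord0| ^+ 2)).
  rewrite ler_wpM2l ?sqr_ge0 //; apply: le_trans wg _; apply: ler_sum => j _.
  by rewrite mxE real_normK ?num_real.
rewrite big_distrr /=; apply: ler_sum => j _.
rewrite mulrCA ler_pM2l // kq.
apply: (@le_trans _ _ ((q ^+ 4 - 1) * ((1 - h) * `|g j ord0|) ^+ 2)).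
  have -> : (q - 1) ^+ 2 ^+ 2 * `|g j ord0| ^+ 2 =
      (q * q - q) ^+ 2 * ((1 - h) * `|g j ord0|) ^+ 2 by rewrite /h; field.
  rewrite ler_wpM2r ?sqr_ge0 //.
  rewrite !exprS expr0 !mulr1; nra.
have g_ge0 : 0 <= (1 - h) * `|g j ord0| by rewrite mulr_ge0 //; lra.
have g_le : (1 - h) * `|g j ord0| <= gam j ord0.
  by apply: le_trans (gam_ge j); rewrite lerDl ltW.
rewrite ler_wpM2l ?subr_ge0 ?exprn_ege1 //.
by rewrite lerXn2r ?nnegrE // (le_trans g_ge0).
Qed.

(** The case of a coordinate j0 with b_j0 below M / (r q^3). There S is taken of
    order q^3, small enough for the quadratic loss to be at most half of the
    linear gain, which is of larger order than the required q^2 p. In the other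
    coordinates S is kept so small that their contribution is nonnegative. *)
Lemma exists_play_small_diag (b : 'I_n -> R) (j0 : 'I_n) (p q : R) (k : nat) :
  4 * M ^+ 2 / r ^+ 2 <= q -> 8 * M ^+ 2 * p / r ^+ 4 <= q -> k%:R = q ^+ 4 ->
  (forall j, 0 < b j) -> b j0 * (r * q ^+ 3) < M ->
  exists m : 'I_n -> nat, (forall j, (m j <= k)%N) /\
    let S j := g0 j ord0 * ((m j)%:R * 2 - k%:R) in
    q ^+ 2 * p <=
    \sum_j (S j * x0 j ord0
            + 2^-1 * (b j * (k%:R * g0 j ord0 ^+ 2 - S j ^+ 2))).
Proof.
move=> q_big qp_big kq b0 bj0.
have rM : r <= M.
  by apply: le_trans (x0_ge j0) _; apply: le_trans (X_le Xx0 j0); exact: ler_norm.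
have r2 : 0 < r ^+ 2 by exact: exprn_gt0.
have M0 : 0 < M by exact: lt_le_trans rM.
have M2 : 0 < M ^+ 2 by exact: exprn_gt0.
have rM2 : r ^+ 2 <= M ^+ 2 by rewrite lerXn2r // nnegrE ltW.
have q4 : 4 <= q.
  apply: le_trans q_big; rewrite ler_pdivlMr //; lra.
have q0 : 0 < q by lra.
have q3 : q <= q ^+ 3 by rewrite -{1}(expr1 q) ler_weXn2l //; lra.
pose c := r ^+ 2 / (2 * M ^+ 2).
have c0 : 0 < c by rewrite divr_gt0 // mulr_gt0.
have c1 : c <= 1 by rewrite ler_pdivrMr ?mulr_gt0 //; lra.
have cq : 2 <= c * q ^+ 3.
  have -> : 2 = c * (4 * M ^+ 2 / r ^+ 2) by rewrite /c; field; rewrite !gt_eqF.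
  by rewrite ler_pM2l // (le_trans q_big).
have k4 : 4 <= k%:R :> R.
  rewrite kq; apply: (le_trans q4); rewrite -{1}(expr1 q) ler_weXn2l //; lra.
have ck : c * q ^+ 3 <= k%:R.
  rewrite kq [q ^+ 4]exprS ler_pM2r ?exprn_gt0 //; lra.
have [|m1 m1k m1P] := @exists_sign_sum_near R k 1; first by lra.
have [|m2 m2k m2P] := @exists_sign_sum_near R k (c * q ^+ 3).
  by rewrite ck andbT; lra.
pose m j := if j == j0 then m2 else m1.
exists m; split=> [j|]; first by rewrite /m; case: ifP.
move=> S.
rewrite (bigD1 j0) //= -[leLHS]addr0; apply: lerD; last first.
  apply: sumr_ge0 => j /negbTE jj0; rewrite /S /m jj0.
  move: m1P; set T := _ - k%:R; rewrite ler_norml => /andP[T0 T2].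
  have g0j := lt_le_trans r_gt0 (g0_ge j); have x0j := lt_le_trans r_gt0 (x0_ge j).
  have T_ge0 : 0 <= T by lra.
  rewrite addr_ge0 //; first by rewrite mulr_ge0 ?(ltW x0j) // mulr_ge0 ?(ltW g0j).
  rewrite mulr_ge0 ?invr_ge0 // mulr_ge0 ?(ltW (b0 j)) // exprMn mulrC -mulrBr.
  rewrite mulr_ge0 ?sqr_ge0 // subr_ge0 expr2; nra.
rewrite /S /m eqxx; move: m2P; set T := _ - k%:R.
rewrite ler_norml => /andP[T_lo T_hi].
have g0j := lt_le_trans r_gt0 (g0_ge j0); have x0j := lt_le_trans r_gt0 (x0_ge j0).
have g0M : g0 j0 ord0 <= M by apply: le_trans (G_le Gg0 j0); exact: ler_norm.
have T0 : 0 <= T by lra.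
set s := g0 j0 ord0 * T.
have s0 : 0 <= s by rewrite mulr_ge0 // ltW.
have rq0 : 0 < r * q ^+ 3 by rewrite mulr_gt0 ?exprn_gt0.
(* The final sum s stays below the maximizer of the parabola of coordinate j0. *)
have bs : b j0 * s <= r.
  have sM : s <= M * (c * q ^+ 3 + 1).
    by apply: ler_pM => //; [exact: ltW | lra].
  rewrite -(ler_pM2r rq0) mulrAC.
  apply: (@le_trans _ _ (M * (M * (c * q ^+ 3 + 1)))).
    by apply: ler_pM => //; [rewrite mulr_ge0 // ltW | exact: ltW].
  have -> : r * (r * q ^+ 3) = M * (M * (2 * (c * q ^+ 3))).
    by rewrite /c; field; rewrite gt_eqF.
  by rewrite !ler_pM2l //; lra.
apply: (@le_trans _ _ (2^-1 * (r * s))); last first.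
  have bg : 0 <= b j0 * (k%:R * g0 j0 ord0 ^+ 2).
    by rewrite mulr_ge0 ?(ltW (b0 j0)) // mulr_ge0 ?sqr_ge0.
  have bs2 : b j0 * s ^+ 2 <= r * s by rewrite expr2 mulrA ler_wpM2r.
  have rs : r * s <= s * x0 j0 ord0 by rewrite mulrC ler_wpM2l.
  by rewrite mulrBr; lra.
apply: (@le_trans _ _ (2^-1 * (r * (r * (2^-1 * (c * q ^+ 3)))))); last first.
  rewrite !ler_pM2l ?invr_gt0 //.
  by apply: ler_pM => //; [exact: ltW | lra | lra].
have -> : 2^-1 * (r * (r * (2^-1 * (c * q ^+ 3)))) =
    q ^+ 2 * (q * (r ^+ 4 / (8 * M ^+ 2))).
  by rewrite /c; field; rewrite gt_eqF.
rewrite ler_pM2l ?exprn_gt0 //.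
apply: le_trans (_ : (8 * M ^+ 2 * p / r ^+ 4) * (r ^+ 4 / (8 * M ^+ 2)) <= _).
  by rewrite le_eqVlt; apply/orP; left; apply/eqP; field; rewrite !gt_eqF.
by rewrite ler_wpM2r // divr_ge0 ?exprn_ge0 ?mulr_ge0 ?exprn_ge0 ?ltW.
Qed.

Lemma qhull_pairing_fin : exists p, qhull_pairing X G = p%:E.
Proof.
have Xv := sub_gen_smallest (ex_intro2 _ _ x0 Xx0 erefl) :
  convex_hull (sqr_set X) _.
have Gw := sub_gen_smallest (ex_intro2 _ _ g0 Gg0 erefl) :
  convex_hull (sqr_set G) _.
have lo := qhull_pairing_ge Xv Gw.
have hi : (qhull_pairing X G <= (n%:R * M ^+ 2)%:E)%E.
  apply: qhull_pairing_le => v w {}Xv {}Gw.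
  rewrite mulr_natl -[n in leRHS]card_ord -sumr_const; apply: ler_sum => j _.
  have /andP[v_ge0 vM] := sqr_hull_bounds X_le Xv j.
  have /andP[w_ge0 wM] := sqr_hull_bounds G_le Gw j.
  rewrite -sqrtrM // -[leRHS]ger0_norm ?sqr_ge0 // -sqrtr_sqr ler_wsqrtr //.
  by rewrite [leRHS]expr2 ler_pM.
exists (fine (qhull_pairing X G)); rewrite fineK //.
by rewrite fin_numElt (lt_le_trans (ltNyr _) lo) (le_lt_trans hi (ltry _)).
Qed.

(** Here q is the fourth root of k, so that (q - 1) ^+ 2 is sqrt k up to a factor
    tending to 1. *)
Lemma exists_large_regret (A : 'M[R]_n) (v w : 'cV[R]_n) (p q : R) (k : nat) :
  posdefmx A -> convex_hull (sqr_set X) v -> convex_hull (sqr_set G) w ->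
  \sum_j Num.sqrt (v j ord0) * Num.sqrt (w j ord0) <= p ->
  1 <= q -> 4 * M ^+ 2 / r ^+ 2 <= q -> 8 * M ^+ 2 * p / r ^+ 4 <= q ->
  k%:R = q ^+ 4 ->
  exists g : nat -> 'cV[R]_n, (forall i, G (g i)) /\
    (((q - 1) ^+ 2 *
       \sum_j Num.sqrt (v j ord0) * Num.sqrt (w j ord0))%:E <=
     sup_regret X A (fun i => dotp (g i)) g k)%E.
Proof.
move=> pA Xv Gw le_p q1 q_big qp_big kq.
set P := \sum_j _ in le_p *.
have BT : (invmx A)^T = invmx A by apply: invmx_sym; case: pA.
have b0 j : 0 < invmx A j j by exact: posdefmx_inv_diag_gt0.
suff [x [gam [m [Xx Ggam mk le_sum]]]] : exists x gam (m : 'I_n -> nat),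
    [/\ X x, G gam, forall j, (m j <= k)%N &
    let S j := gam j ord0 * ((m j)%:R * 2 - k%:R) in
    (q - 1) ^+ 2 * P <=
    \sum_j (S j * x j ord0
            + 2^-1 * (invmx A j j * (k%:R * gam j ord0 ^+ 2 - S j ^+ 2)))].
  have [g [Gg [y Xy le_regret]]] :=
    signed_play_regret X_ortho G_ortho BT Xx Ggam mk.
  exists g; split=> //; apply: le_trans (ereal_sup_ubound _); last by exists y.
  by rewrite lee_fin; apply: le_trans le_sum le_regret.
have [[j0 small]|large] :=
  pselect (exists j0, invmx A j0 j0 * (r * q ^+ 3) < M).
  have [m [mk le_sum]] := exists_play_small_diag q_big qp_big kq b0 small.
  exists x0, g0, m; split => //; apply: le_trans le_sum.
  have P0 : 0 <= P by apply: sumr_ge0 => j _; rewrite mulr_ge0 ?sqrtr_ge0.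
  apply: ler_pM => //; first by rewrite sqr_ge0.
  by rewrite ler_sqr ?nnegrE //; lra.
apply: exists_play_large_diag => // j.
by rewrite leNgt; apply/negP => small; apply: large; exists j.
Qed.

Lemma limn_einf_ge (u : nat -> \bar R) (a : \bar R) (K : nat) :
  (forall k, (K <= k)%N -> (a <= u k)%E) -> (a <= limn_einf u)%E.
Proof.
move=> au; rewrite limn_einf_lim.
apply: (@le_trans _ _ (einfs u K)).
  by apply: le_ereal_inf_tmp => _ [k /= Kk <-]; exact: au.
rewrite (cvg_lim _ (@cvg_einfs_sup _ u)) //.
by apply: ereal_sup_ubound; exists K.
Qed.

(** For each k, the play is built from a pair (v, w) within 1 / q of the
    supremum, with q the fourth root of k. *)
Lemma euclidean_lower_bound (A : nat -> 'M[R]_n) :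
  (forall k, (1 <= k)%N -> posdefmx (A k)) ->
  exists g : nat -> nat -> 'cV[R]_n,
    (forall k i, G (g k i)) /\
    (qhull_pairing X G <=
     limn_einf (fun k : nat =>
       ((Num.sqrt k%:R)^-1)%:E *
       sup_regret X (A k) (fun i => dotp (g k i)) (g k) k))%E.
Proof.
move=> pA; have [p pE] := qhull_pairing_fin.
have le_p v w : convex_hull (sqr_set X) v -> convex_hull (sqr_set G) w ->
    \sum_j Num.sqrt (v j ord0) * Num.sqrt (w j ord0) <= p.
  by move=> Xv Gw; rewrite -lee_fin -pE; exact: qhull_pairing_ge.
have near_p e : 0 < e -> exists v w, [/\ convex_hull (sqr_set X) v,
    convex_hull (sqr_set G) w &
    p - e <= \sum_j Num.sqrt (v j ord0) * Num.sqrt (w j ord0)].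
  move=> e0; apply: contrapT => no.
  suff : (qhull_pairing X G <= (p - e)%:E)%E by rewrite pE lee_fin; lra.
  apply: qhull_pairing_le => v w Xv Gw; rewrite leNgt; apply/negP => lt.
  by apply: no; exists v, w; split => //; exact: ltW.
pose q k : R := Num.sqrt (Num.sqrt k%:R).
pose Q := 1 + (4 * M ^+ 2 / r ^+ 2 + 8 * M ^+ 2 * p / r ^+ 4).
have sqrtk k : Num.sqrt k%:R = q k ^+ 2 by rewrite sqr_sqrtr ?sqrtr_ge0.
have qk k : k%:R = q k ^+ 4.
  by rewrite -[4%N]/(2 * 2)%N exprM -sqrtk sqr_sqrtr.
have p0 : 0 <= p.
  have [v [w [Xv Gw _]]] := near_p 1 ltr01.
  apply: le_trans (le_p v w Xv Gw); apply: sumr_ge0 => j _.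
  by rewrite mulr_ge0 ?sqrtr_ge0.
have M0 : 0 <= 4 * M ^+ 2 / r ^+ 2.
  by rewrite divr_ge0 ?sqr_ge0 // mulr_ge0 ?sqr_ge0.
have Mp0 : 0 <= 8 * M ^+ 2 * p / r ^+ 4.
  by rewrite divr_ge0 ?exprn_ge0 ?(ltW r_gt0) // mulr_ge0 // mulr_ge0 ?sqr_ge0.
have /choice [g gP] : forall k, exists g : nat -> 'cV[R]_n, (forall i, G (g i)) /\
    (Q <= q k -> (((q k - 1) ^+ 2 * (p - (q k)^-1))%:E <=
     sup_regret X (A k) (fun i => dotp (g i)) g k)%E).
  move=> k; have [Qq|_] := leP Q (q k); last by exists (fun=> g0).
  have q1 : 1 <= q k by rewrite /Q in Qq; lra.
  have k1 : (1 <= k)%N.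
    rewrite lt0n; apply/eqP => k0; move: q1.
    by rewrite /q k0 !sqrtr0 ler10.
  have q0 : 0 < (q k)^-1 by rewrite invr_gt0; lra.
  have [v [w [Xv Gw near]]] := near_p _ q0.
  have [||g [Gg le_g]] :=
    exists_large_regret (pA k k1) Xv Gw (le_p _ _ Xv Gw) q1 _ _ (qk k).
  - by rewrite /Q in Qq; lra.
  - by rewrite /Q in Qq; lra.
  exists g; split=> // _; apply: le_trans le_g.
  by rewrite lee_fin ler_wpM2l ?sqr_ge0.
exists g; split=> [k i|]; first by have [] := gP k.
rewrite pE; apply/lee_addgt0Pr => e e0.
rewrite -leeBlDr // -EFinB.
(* The ratio is at least (1 - h) ^+ 2 * (p - h) >= p - h * (1 + 2 * p) for
   h = (q k)^-1, hence at least p - e as soon as q k is at least this N. *)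
pose N := Num.max Q ((1 + 2 * p) / e).
have N0 : 0 <= N by rewrite le_max /Q; apply/orP; left; lra.
apply: (@limn_einf_ge _ _ (Num.truncn (N ^+ 4)).+1) => k Nk.
have Nq : N <= q k.
  rewrite leNgt; apply/negP => qN.
  have : q k ^+ 4 < N ^+ 4.
    by rewrite ltr_pXn2r ?nnegrE ?sqrtr_ge0.
  rewrite -qk ltNge => /negP; apply.
  by apply: le_trans (ltW (truncnS_gt _)) _; rewrite ler_nat.
have [_] := gP k; rewrite sqrtk.
have [Qq qe] : Q <= q k /\ (1 + 2 * p) / e <= q k.
  by move: Nq; rewrite ge_max => /andP[].
move=> /(_ Qq) le_sup.
have q1 : 1 <= q k by rewrite /Q in Qq; lra.
have q0 : 0 < q k by lra.
have qn0 : q k != 0 by rewrite gt_eqF.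
apply: le_trans (lee_wpmul2l _ le_sup); last first.
  by rewrite lee_fin invr_ge0 sqr_ge0.
rewrite -EFinM lee_fin mulrA.
set h := (q k)^-1.
have -> : q k ^- 2 * (q k - 1) ^+ 2 = (1 - h) ^+ 2 by rewrite /h; field.
have h0 : 0 < h by rewrite invr_gt0.
have h1 : h <= 1 by rewrite invf_le1.
have he : h * (1 + 2 * p) <= e.
  by rewrite /h mulrC ler_pdivrMr // [e * _]mulrC -ler_pdivrMr.
have h2 : 0 <= h * h by rewrite mulr_ge0 // ltW.
have -> : (1 - h) ^+ 2 * (p - h) =
  p - h * (1 + 2 * p) + h * h * p + h * h * (2 - h) by ring.
have : 0 <= h * h * p by rewrite mulr_ge0.
have : 0 <= h * h * (2 - h) by rewrite mulr_ge0 //; lra.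
lra.
Qed.

Lemma euclidean_upper_bound (k : nat) : (1 <= k)%N ->
  exists D : 'M[R]_n, [/\ is_diag_mx D, posdefmx D &
    forall (F : nat -> 'cV[R]_n -> R) (g : nat -> 'cV[R]_n),
      (forall i, (1 <= i <= k)%N -> G (g i)) -> euclidean_play D F k g ->
      (((Num.sqrt k%:R)^-1)%:E * sup_regret X D F g k
       <= qhull_pairing X G)%E].
Proof.
move=> k1; have [p pE] := qhull_pairing_fin.
have sqr_in (C : set 'cV[R]_n) x (Cx : C x) :
    convex_hull (sqr_set C) (\col_j (x j ord0 ^+ 2)).
  by apply: sub_gen_smallest; exists x.
have [d [d0 dP]] : exists d : 'I_n -> R, (forall j, 0 < d j) /\
    forall v w, convex_hull (sqr_set X) v -> convex_hull (sqr_set G) w ->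
    \sum_j d j * v j ord0 + \sum_j (d j)^-1 * w j ord0 <= 2 * p.
  apply: (@minimax_scaling _ _ _ _ M p (r ^+ 2) (\col_j (x0 j ord0 ^+ 2))
    (\col_j (g0 j ord0 ^+ 2))); try exact: convex_hull_convex.
  - by move=> v; exact: sqr_hull_bounds.
  - by move=> v; exact: sqr_hull_bounds.
  - exact: M_ge0.
  - exact: exprn_gt0.
  - exact: sqr_in.
  - exact: sqr_in.
  - by move=> j; rewrite mxE lerXn2r ?nnegrE ?(ltW r_gt0) // (le_trans (ltW r_gt0)).
  - by move=> j; rewrite mxE lerXn2r ?nnegrE ?(ltW r_gt0) // (le_trans (ltW r_gt0)).
  - by move=> v w Xv Gw; rewrite -lee_fin -pE; exact: qhull_pairing_ge.
have sk0 : 0 < Num.sqrt k%:R :> R by rewrite sqrtr_gt0 ltr0n.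
set sk := Num.sqrt k%:R in sk0 *.
have b0 j : 0 < sk * d j by exact: mulr_gt0.
exists (diag_mx (\row_j (sk * d j))); split.
- exact: diag_mx_is_diag.
- exact: posdefmx_diag.
move=> F g Gg play; rewrite pE.
set D := diag_mx _ in play *.
have sup_le : (sup_regret X D F g k <= (sk * p)%R%:E)%E.
  apply: ge_ereal_sup => _ [x Xx <-]; rewrite lee_fin.
  apply: le_trans (diagonal_regret_le x b0 play) _.
  have skn0 : sk != 0 by rewrite gt_eqF.
  have sk2 : sk * sk = k%:R by rewrite -expr2 sqr_sqrtr.
  have -> : \sum_j sk * d j * x j ord0 ^+ 2 =
      sk^-1 * \sum_(1 <= i < k.+1) \sum_j d j * x j ord0 ^+ 2.
    rewrite sumr_const_nat subSS subn0 -[in RHS]mulr_natl -sk2 mulrA mulKf //.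
    by rewrite big_distrr; apply: eq_bigr => j _ /=; rewrite [RHS]mulrA.
  have -> : \sum_(1 <= i < k.+1) \sum_j (sk * d j)^-1 * g i j ord0 ^+ 2 =
      sk^-1 * \sum_(1 <= i < k.+1) \sum_j (d j)^-1 * g i j ord0 ^+ 2.
    rewrite big_distrr; apply: eq_bigr => i _ /=.
    by rewrite big_distrr; apply: eq_bigr => j _ /=; rewrite invfM [RHS]mulrA.
  rewrite -mulrDr -big_split /=.
  have rounds : \sum_(1 <= i < k.+1) (\sum_j d j * x j ord0 ^+ 2 +
      \sum_j (d j)^-1 * g i j ord0 ^+ 2) <= \sum_(1 <= i < k.+1) (2 * p).
    rewrite big_nat_cond [leRHS]big_nat_cond; apply: ler_sum => i.
    rewrite andbT ltnS => /Gg Ggi.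
    have := dP _ _ (sqr_in _ _ Xx) (sqr_in _ _ Ggi).
    under eq_bigr do rewrite mxE.
    by under [X in _ + X <= _ -> _]eq_bigr do rewrite mxE.
  rewrite sumr_const_nat subSS subn0 -[2 * p *+ k]mulr_natl -sk2 in rounds.
  apply: le_trans (_ : 2^-1 * (sk^-1 * (sk * sk * (2 * p))) <= _).
    by rewrite !ler_pM2l ?invr_gt0.
  by rewrite le_eqVlt; apply/orP; left; apply/eqP; field.
apply: le_trans (lee_wpmul2l _ sup_le) _; first by rewrite lee_fin invr_ge0 ltW.
by rewrite -EFinM lee_fin mulKf ?gt_eqF.
Qed.

End Bodies.

Theorem theorem5 (R : realType) (n : nat) (X G : set 'cV[R]_n)
  (X_body : convex_body X) (X_ortho : orthosymmetric X)
  (G_body : convex_body G) (G_ortho : orthosymmetric G) :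
  (forall A : nat -> 'M[R]_n,
     (forall k, (1 <= k)%N -> posdefmx (A k)) ->
     exists g : nat -> nat -> 'cV[R]_n,
       (forall k i, (1 <= i <= k)%N -> G (g k i)) /\
       (qhull_pairing X G <=
        limn_einf (fun k : nat =>
          ((Num.sqrt k%:R)^-1)%:E *
          sup_regret X (A k) (fun i => dotp (g k i)) (g k) k))%E) /\
  (forall k : nat, (1 <= k)%N ->
     exists D : 'M[R]_n,
       [/\ is_diag_mx D, posdefmx D &
         forall (F : nat -> 'cV[R]_n -> R) (g : nat -> 'cV[R]_n),
           (forall i, (1 <= i <= k)%N ->
              convex_function [set: 'cV[R]_n] (F i)) ->
           (forall i, (1 <= i <= k)%N ->
              forall x, subdifferential (F i) x `<=` G) ->
           euclidean_play D F k g ->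
           (((Num.sqrt k%:R)^-1)%:E * sup_regret X D F g k
            <= qhull_pairing X G)%E]).
Proof.
have [MX MX0 X_le] := convex_body_bounded X_body.
have [MG MG0 G_le] := convex_body_bounded G_body.
have [rX rX0 [x0 Xx0 x0_ge]] := orthosymmetric_body_positive X_body X_ortho.
have [rG rG0 [g0 Gg0 g0_ge]] := orthosymmetric_body_positive G_body G_ortho.
have [_ G_convex _] := G_body.
pose M := Num.max MX MG; pose r := Num.min rX rG.
have M0 : 0 <= M by rewrite le_max ltW.
have r0 : 0 < r by rewrite lt_min rX0.
have X_leM x : X x -> forall j, `|x j ord0| <= M.
  by move=> Xx j; rewrite le_max X_le.
have G_leM x : G x -> forall j, `|x j ord0| <= M.
  by move=> Gx j; rewrite le_max G_le ?orbT.
have x0_ger j : r <= x0 j ord0 by rewrite ge_min x0_ge.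
have g0_ger j : r <= g0 j ord0 by rewrite ge_min g0_ge orbT.
split=> [A pA|k k1].
  have [g [Gg le_lim]] := euclidean_lower_bound G_convex X_ortho G_ortho r0 M0
    Xx0 Gg0 x0_ger g0_ger X_leM G_leM pA.
  by exists g; split=> // k i _; exact: Gg.
have [D [diagD pD le_D]] := euclidean_upper_bound r0 M0 Xx0 Gg0 x0_ger g0_ger
  X_leM G_leM k1.
exists D; split=> // F g _ subG play; apply: le_D => // i ik.
exact: subG i ik _ _ (play i ik).
Qed.
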